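(* Let $n,k$ be integers with $n>2k\geq 4$. Then \[ m(n,k,3,2)=\binom{n-2}{k-2}. \] Moreover, if $\mathcal{F}\subset\binom{[n]}{k}$ is $3$-wise $2$-intersecting with $|\mathcal{F}|=\binom{n-2}{k-2}$, then $\mathcal{F}$ is a full $2$-star, i.e. $\mathcal{F}=\{F\in\binom{[n]}{k}: T\subset F\}$ for some $2$-element set $T\subset[n]$.
   Context: $\binom{[n]}{k}$ is the set of $k$-element subsets of $[n]=\{1,\dots,n\}$. A family $\mathcal{F}$ is $r$-wise $t$-intersecting if $|F_1\cap\dots\cap F_r|\geq t$ for all (not necessarily distinct) $F_1,\dots,F_r\in\mathcal{F}$. $m(n,k,r,t)$ is the maximum of $|\mathcal{F}|$ over all $r$-wise $t$-intersecting families $\mathcal{F}\subset\binom{[n]}{k}$. *)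

(* Defs.v *)
From mathcomp Require Import all_boot.

Set Implicit Arguments.
Unset Strict Implicit.
Unset Printing Implicit Defensive.

(* [n] = {1, ..., n} is modelled by the ordinal type 'I_n. *)
Definition ksubsets (n k : nat) : {set {set 'I_n}} :=
  [set A : {set 'I_n} | #|A| == k].

(* The tuple G lists F_1, ..., F_r, with repetitions allowed. *)
Definition wise_intersecting (n r t : nat) (F : {set {set 'I_n}}) : bool :=
  [forall G : {ffun 'I_r -> {set 'I_n}},
     [forall i, G i \in F] ==> (t <= #|\bigcap_(i < r) G i|)].

(* The empty family is admissible, so the maximum is over a nonempty set. *)
Definition max_wise_intersecting (n k r t : nat) : nat :=
  \max_(F : {set {set 'I_n}} |
        (F \subset ksubsets n k) && wise_intersecting r t F) #|F|.

Definition full_star (n k t : nat) (F : {set {set 'I_n}}) : Prop :=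
  exists2 T : {set 'I_n},
    #|T| = t & F = [set A in ksubsets n k | T \subset A].

(* Main.v *)
Require Import Defs.
From mathcomp Require Import all_boot.
From mathcomp Require Import zify.

Set Implicit Arguments.
Unset Strict Implicit.
Unset Printing Implicit Defensive.

(* Compress [F] by the shifts replacing [j] by a smaller [i]. In a shifted family
   that is not a star on the first two points, some member contains the first
   but not the second, so the links of the members containing both are pairwise
   intersecting and number at most [C(n-3, k-3)] by Erdos-Ko-Rado. The members
   containing only the first, resp. missing the first, have links that are
   3-wise 3-, resp. 4-intersecting, and a 3-wise t-intersecting shifted family
   has at most [(5/4)^(t-1) C(n-t, k-t)] members; altogether this stays below
   [C(n-2, k-2)]. Finally, if a shift of [F] is a full star on [T], two of its
   members meeting exactly in [T] come from two members of [F] meeting in two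
   points, and every member of [F] contains these. *)

(** * Families of words *)

Fixpoint words n : seq (seq bool) :=
  if n is m.+1 then map (cons true) (words m) ++ map (cons false) (words m)
  else [:: [::]].

Definition cnt n (P : pred (seq bool)) := count P (words n).

Lemma mem_words n u : (u \in words n) = (size u == n).
Proof.
elim: n u => [|n IH] [|b u] //=.
  by rewrite mem_cat; apply/negbTE/norP; split; apply/mapP => -[].
rewrite mem_cat eqSS -IH; case: b.
  rewrite mem_map; last by move=> ? ? [].
  by case: (u \in words n) => //=; apply/mapP => -[].
rewrite [X in _ || X]mem_map; last by move=> ? ? [].
by rewrite orbC; case: (u \in words n) => //=; apply/mapP => -[].
Qed.

Lemma cnt_cons n P :
  cnt n.+1 P = cnt n (fun u => P (true :: u)) + cnt n (fun u => P (false :: u)).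
Proof. by rewrite /cnt /= count_cat !count_map. Qed.

(** The Erdos-Ko-Rado induction deletes the last point, the other recursions delete the first; hence
    two ways of splitting a count. *)
Lemma cnt_rcons n P :
  cnt n.+1 P = cnt n (fun u => P (rcons u true)) + cnt n (fun u => P (rcons u false)).
Proof.
elim: n P => [|n IH] P; first by rewrite cnt_cons.
rewrite cnt_cons (IH (fun u => P (true :: u))) (IH (fun u => P (false :: u))).
by rewrite [X in _ = X + _]cnt_cons [X in _ = _ + X]cnt_cons /= addnACA.
Qed.

Lemma sub_cnt n (P Q : pred (seq bool)) :
  (forall u, size u = n -> P u -> Q u) -> cnt n P <= cnt n Q.
Proof.
move=> PQ; rewrite /cnt -!size_filter.
have -> : [seq u <- words n | P u] = [seq u <- [seq u <- words n | Q u] | P u].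
  rewrite -filter_predI; apply: eq_in_filter => u /=; rewrite mem_words => /eqP su.
  by case Pu: (P u) => //; rewrite PQ.
by rewrite size_filter count_size.
Qed.

Lemma cnt0 n (P : pred (seq bool)) :
  (forall u, size u = n -> ~~ P u) -> cnt n P = 0.
Proof.
move=> P0; apply/eqP; rewrite -leqn0.
by rewrite (leq_trans (sub_cnt (Q := pred0) _)) ?/cnt ?count_pred0 // => u /P0/negbTE->.
Qed.

Lemma cnt_weight n k : cnt n (fun u => count id u == k) = 'C(n, k).
Proof.
elim: n k => [|n IH] k; first by case: k.
rewrite cnt_cons /=; case: k => [|k].
  by rewrite cnt0 // [LHS]IH !bin0.
by rewrite binS addnC -!IH; congr (_ + _).
Qed.

Lemma cnt_negb n (P : pred (seq bool)) :
  cnt n (fun u => P (map negb u)) = cnt n P.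
Proof.
elim: n P => [//|n IH] P.
by rewrite !cnt_cons /= (IH (fun u => P (false :: u))) (IH (fun u => P (true :: u))) addnC.
Qed.

(** * Intersections, shiftedness and links of words *)

Fixpoint inter3 (u v w : seq bool) : nat :=
  match u, v, w with
  | a :: u', b :: v', c :: w' => [&& a, b & c] + inter3 u' v' w'
  | _, _, _ => 0
  end.

Lemma inter3C u v w : inter3 u v w = inter3 v u w.
Proof. by elim: u v w => [|a u IH] [|b v] [|c w] //=; rewrite IH andbCA. Qed.

Lemma inter3_uu u : inter3 u u u = count id u.
Proof. by elim: u => [|b u IH] //=; rewrite IH !andbb. Qed.

Lemma inter3_rcons u v w a b c : size v = size u -> size w = size u ->
  inter3 (rcons u a) (rcons v b) (rcons w c) = inter3 u v w + [&& a, b & c].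
Proof.
elim: u v w => [|x u IH] [|y v] [|z w] //=; first by rewrite addn0.
by move=> [sv] [sw]; rewrite IH // addnA.
Qed.

Lemma inter3_drop2 u v w : inter3 u v w <= inter3 u v v.
Proof.
elim: u v w => [|a u IH] [|b v] [|c w] //=.
by apply: leq_add => //; case: a b c => [] [] [].
Qed.

(** The split of [u] at a common point has the shape required by [shifted], so that this point can
    be traded for an earlier one. *)
Lemma inter3_remove u v w : 0 < inter3 u v w ->
  exists a b, u = a ++ true :: b /\
    inter3 (a ++ false :: b) v w = (inter3 u v w).-1.
Proof.
elim: u v w => [|x u IH] [|y v] [|z w] //=.
have [/and3P[-> -> ->] _|/negbTE E] := boolP [&& x, y & z].
  by exists [::], u.
rewrite add0n => /IH [a [b [-> eq_ab]]]; exists (x :: a), b; split=> //=.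
by rewrite E add0n.
Qed.

Definition uniform n k (P : pred (seq bool)) :=
  forall u, P u -> size u = n /\ count id u = k.

Definition shifted (P : pred (seq bool)) := forall u v w,
  P (u ++ false :: v ++ true :: w) -> P (u ++ true :: v ++ false :: w).

Definition threewise t (P : pred (seq bool)) := forall u v w,
  P u -> P v -> P w -> t <= inter3 u v w.

(** Repeating [v] turns [inter3] into a count of pairwise intersections. *)
Definition intersecting (P : pred (seq bool)) := forall u v,
  P u -> P v -> 0 < inter3 u v v.

Lemma shifted_cons b P : shifted P -> shifted (fun u => P (b :: u)).
Proof. by move=> shP u v w; apply: (shP (b :: u)). Qed.

Lemma shifted_rcons b P : shifted P -> shifted (fun u => P (rcons u b)).
Proof.
move=> shP u v w; rewrite !rcons_cat /= !rcons_cat /=; exact: shP.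
Qed.

Lemma uniform_true n k P : uniform n.+1 k.+1 P -> uniform n k (fun u => P (true :: u)).
Proof. by move=> unP u /unP /= [[su] [cu]]. Qed.

Lemma uniform_false n k P : uniform n.+1 k P -> uniform n k (fun u => P (false :: u)).
Proof. by move=> unP u /unP /= [[su] cu]. Qed.

Lemma cnt_threewise0 n k t P : uniform n k P -> threewise t P -> k < t -> cnt n P = 0.
Proof.
move=> unP P3 ltkt; apply: cnt0 => u _; apply/negP => Pu.
by move: (P3 _ _ _ Pu Pu Pu); rewrite inter3_uu (unP _ Pu).2 leqNgt ltkt.
Qed.

Lemma threewise_true t P : threewise t.+1 P -> threewise t (fun u => P (true :: u)).
Proof. by move=> P3 u v w Pu Pv Pw; have := P3 _ _ _ Pu Pv Pw. Qed.

(** Shift a common point of [u] to the first place: [v] and [w] lack the first point, so the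
    intersection drops by one. Doing the same with [v] costs one more, since [w] still lacks it. As
    [t.+1] common points remain after both shifts, there were [t.+3] at the start. *)
Lemma threewise_false t P : shifted P -> threewise t.+1 P ->
  threewise t.+3 (fun u => P (false :: u)).
Proof.
move=> shP P3 u v w Pu Pv Pw.
have := P3 _ _ _ Pu Pv Pw; rewrite /= => t1.
have [|a [b [eu e1]]] := @inter3_remove u v w; first by lia.
have Pu' : P (true :: a ++ false :: b) by apply: (shP [::]); rewrite /= -eu.
have := P3 _ _ _ Pu' Pv Pw; rewrite /= e1 => t2.
have [|c [d [ev e2]]] := @inter3_remove v (a ++ false :: b) w.
  by rewrite inter3C e1; lia.
have Pv' : P (true :: c ++ false :: d) by apply: (shP [::]); rewrite /= -ev.
have := P3 _ _ _ Pu' Pv' Pw; rewrite /= inter3C e2 inter3C e1; lia.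
Qed.

(** * The Erdos-Ko-Rado theorem for shifted families *)

Lemma common_zero u v : size u = size v -> count id u + count id v < size u ->
  inter3 u v v = 0 -> exists a b, u = a ++ false :: b /\
    inter3 (a ++ true :: b) v v = 0.
Proof.
elim: u v => [|x u IH] [|y v] //= [suv].
case: x; case: y => //=; rewrite ?add0n ?add1n => lt uv.
- by have [|a [b [-> e]]] := IH v suv _ uv; [lia | exists (true :: a), b].
- by have [|a [b [-> e]]] := IH v suv _ uv; [lia | exists (false :: a), b].
- by exists [::], u.
Qed.

(** If [u] and [v] were disjoint, then [k + k < n] would leave a position outside both. Shifting the
    last point of one word there would produce a member disjoint from the other word. *)
Lemma intersecting_rcons_true n k P : uniform n.+1 k.+1 P -> 2 * k.+1 <= n.+1 -> shifted P ->
  intersecting P -> intersecting (fun u => P (rcons u true)).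
Proof.
move=> unP kn shP P2 u v Pu Pv.
have [su cu] := unP _ Pu; have [sv cv] := unP _ Pv.
move: su sv cu cv; rewrite !size_rcons -!cats1 !count_cat /= !addn0 !addn1.
move=> [su] [sv] [cu] [cv].
rewrite lt0n; apply/eqP => uv0.
have [||a [b [eu e]]] := @common_zero u v _ _ uv0; rewrite ?su ?sv ?cu ?cv //; first by lia.
have Pu' : P (rcons (a ++ true :: b) false).
  rewrite -cats1 -catA /= ; apply: shP; rewrite -cat_cons catA -eu cats1 //.
have sa : size v = size (a ++ true :: b) by rewrite sv -su eu !size_cat.
by have := P2 _ _ Pu' Pv; rewrite inter3_rcons ?e.
Qed.

Lemma count_negb (u : seq bool) : count id (map negb u) = size u - count id u.
Proof.
by rewrite count_map -(count_predC id u) addKn.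
Qed.

Lemma inter3_negb u : inter3 u (map negb u) (map negb u) = 0.
Proof. by elim: u => [|[] u IH]. Qed.

(** Induction on [n] by the last letter: both parts are again shifted and intersecting, and Pascal's
    rule adds up their bounds. The case [n = 2 * k.+1], where the part ending in [false] would
    violate the hypothesis, is settled by complements. *)
Lemma EKR n k P : uniform n k.+1 P -> 2 * k.+1 <= n -> shifted P -> intersecting P ->
  cnt n P <= 'C(n.-1, k).
Proof.
elim: n k P => [//|n IH] k P unP kn shP P2.
have [e|{}kn'] := leqP n.+1 (2 * k.+1).
  have {e kn} en : n.+1 = 2 * k.+1 by lia.
  (* A word is disjoint from its complement, so at most one of the two lies in [P]; hence [P] takes
     at most half of all words of weight [k.+1]. *)
  have le2 : cnt n.+1 P + cnt n.+1 (fun u => P (map negb u)) <= 'C(n.+1, k.+1).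
    rewrite -cnt_weight /cnt -count_predUI.
    rewrite (@eq_count _ (predI _ _) pred0) ?count_pred0 ?addn0; last first.
      move=> u /=; apply/negP => /andP[Pu Pu'].
      by have := P2 _ _ Pu Pu'; rewrite inter3_negb.
    apply: (@sub_cnt n.+1) => u su /= /orP[/unP[_ ->]//|/unP[_]].
    by rewrite count_negb su; lia.
  rewrite cnt_negb in le2; rewrite /=.
  have : 'C(n, k.+1) = 'C(n, k) by rewrite -bin_sub; [congr 'C(_, _)|]; lia.
  by move: le2; rewrite binS; lia.
rewrite cnt_rcons; case: n IH unP kn kn' => [|n] IH unP kn kn'; first by lia.
have un1 : uniform n.+1 k (fun u => P (rcons u true)).
  by move=> u /unP; rewrite size_rcons -cats1 count_cat /= addn1 => -[[su] [cu]].
have un0 : uniform n.+1 k.+1 (fun u => P (rcons u false)).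
  by move=> u /unP; rewrite size_rcons -cats1 count_cat /= !addn0 => -[[su] cu].
have P0 : intersecting (fun u => P (rcons u false)).
  move=> u v Pu Pv; have := P2 _ _ Pu Pv.
  by rewrite inter3_rcons ?addn0 // (un0 _ Pu).1 (un0 _ Pv).1.
have P1 := intersecting_rcons_true unP kn shP P2.
(* For weight one, a member ending in [true] would leave an empty word, which does not meet
   itself. *)
have := IH _ _ un0 _ (shifted_rcons shP) P0; case: k un1 {un0 unP} kn kn' => [|k] un1 kn kn'.
  rewrite (@cnt0 _ (fun u => P (rcons u true))) ?bin0 ?add0n; first by apply; lia.
  move=> u _; apply/negP => Pu; have := P1 _ _ Pu Pu.
  by rewrite inter3_uu (un1 _ Pu).2.
have := IH _ _ un1 _ (shifted_rcons shP) P1; rewrite /= binS => /(_ ltac:(lia)).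
by move=> le1 /(_ ltac:(lia)) le0; lia.
Qed.

(** * Bounds for shifted families of words *)

(** The quotient of the binomials is the proportion of words of weight [k.+2] that read true, true,
    false at three given places. With density below one half this is at most 1/8. *)
Lemma bin_eighth n k : 2 * k.+2 < n.+3 -> 8 * 'C(n, k) <= 'C(n.+3, k.+2).
Proof.
(* In terms of the excess [d], the difference of the two cubic products has only nonnegative
   coefficients. *)
move=> lt_kn; have [d en] : exists d, n = 2 * k + 2 + d.
  by exists (n - (2 * k + 2)); lia.
have e1 := mul_bin_diag n.+3 k.+1; have e2 := mul_bin_diag n.+2 k.
have e3 := mul_bin_down n.+1 k; rewrite /= in e1 e2 e3.
have e : (k.+2 * k.+1 * (n.+1 - k)) * 'C(n.+3, k.+2) = (n.+3 * n.+2 * n.+1) * 'C(n, k).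
  rewrite [LHS](_ : _ = k.+1 * (n.+1 - k) * (k.+2 * 'C(n.+3, k.+2))); last by lia.
  rewrite -e1 [LHS](_ : _ = n.+3 * (n.+1 - k) * (k.+1 * 'C(n.+2, k.+1))); last by lia.
  rewrite -e2 [LHS](_ : _ = n.+3 * n.+2 * ((n.+1 - k) * 'C(n.+1, k))); last by lia.
  by rewrite -e3 mulnA.
have le : 8 * (k.+2 * k.+1 * (n.+1 - k)) <= n.+3 * n.+2 * n.+1.
  rewrite en; have -> : (2 * k + 2 + d).+1 - k = k + 3 + d by lia.
  have -> : (2 * k + 2 + d).+3 * (2 * k + 2 + d).+2 * (2 * k + 2 + d).+1 =
    8 * (k.+2 * k.+1 * (k + 3 + d)) +
      (6 * k.+2 + d * (4 * k * k + 24 * k + 31) + 6 * k.+2 * d * d + d * d * d) by lia.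
  exact: leq_addr.
have pos : 0 < k.+2 * k.+1 * (n.+1 - k) by rewrite !muln_gt0 /=; lia.
rewrite -(leq_pmul2l pos) e; move: ('C(n, k)) => C; nia.
Qed.

(* If the members avoiding the first point are 3-wise (t+2)-intersecting and
   those containing it 3-wise (t-1)-intersecting, a bound [c_t 'C(n - t, k - t)]
   propagates as soon as [c_(t-1) + c_(t+2) / 8 <= c_t]; [(5/4) ^ (t-1)] works. *)
Lemma threewise_bound n k s P : uniform n k P -> shifted P -> threewise s.+1 P ->
  s < k -> 2 * k <= n + s -> 4 ^ s * cnt n P <= 5 ^ s * 'C(n - s.+1, k - s.+1).
Proof.
elim: n k s P => [|n IH] k s P unP shP P3 lt_sk le_kn; first by lia.
(* At [s = 0] the hypothesis becomes [2 * k <= n], that of [EKR]; removing a first letter [true]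
   lowers both sides of it by two. *)
case: s P3 lt_sk le_kn => [|s] P3 lt_sk le_kn.
  case: k unP lt_sk le_kn => // k unP _ le_kn.
  rewrite !expn0 !mul1n !subn1; apply: (EKR unP) => //; first by lia.
  move=> u v Pu Pv; exact: P3.
case: k unP lt_sk le_kn => // k unP lt_sk le_kn.
have IH1 : 4 ^ s * cnt n (fun u => P (true :: u)) <= 5 ^ s * 'C(n - s.+1, k - s.+1).
  apply: IH; [exact: uniform_true | exact: shifted_cons | exact: threewise_true | lia | lia].
have P0 := threewise_false shP P3; have u0 := uniform_false unP.
rewrite cnt_cons !subSS.
(* Members avoiding the first point have weight [k.+1] and would need [s.+4] common points. *)
have [lek|ltk] := ltnP k.+1 s.+4.
  rewrite (cnt_threewise0 u0 P0) ?addn0 //; rewrite !expnS.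
  by move: IH1; set x := _ * cnt _ _; set y := _ * 'C(_, _); nia.
have IH0 : 4 ^ s.+3 * cnt n (fun u => P (false :: u)) <= 5 ^ s.+3 * 'C(n - s.+4, k.+1 - s.+4).
  by apply: IH => //; [exact: shifted_cons | lia].
have le8 : 8 * 'C(n - s.+4, k.+1 - s.+4) <= 'C(n - s.+1, k - s.+1).
  have -> : n - s.+1 = (n - s.+4).+3 by lia.
  have -> : k - s.+1 = (k.+1 - s.+4).+2 by lia.
  by apply: bin_eighth; lia.
rewrite !expnS in IH0 *.
move: IH1 IH0 le8; set a := cnt _ _; set b := cnt _ _.
set C := 'C(_, _); set D := 'C(_, _); move: (4 ^ s) (5 ^ s) => x y le1 le0 le8.
(* The two parts contribute at most [4 * y * C] and [(125/128) * y * C], together less than the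
   allowed [5 * y * C]. *)
have : y * (8 * D) <= y * C by rewrite leq_mul2l le8 orbT.
by nia.
Qed.

Lemma nontrivial_bound n k P : 2 * k < n -> uniform n k P -> shifted P ->
  threewise 2 P -> forall x, P x -> ~~ [&& nth false x 0 & nth false x 1] ->
  cnt n P < 'C(n - 2, k - 2).
Proof.
move=> lt_kn unP shP P3 x Px nx.
have le2k : 2 <= k by rewrite -(unP _ Px).2 -inter3_uu P3.
case: k le2k lt_kn unP => [|[|k]] // _; case: n => [|[|n]] // lt_kn unP.
(* If [x] lacks the first point, shift one of its points there: the second if present, otherwise any
   later one. *)
have [y Py] : exists y, P (true :: false :: y).
  have [sx cx] := unP _ Px.
  case: x sx cx Px nx => [|[] [|[] x]] //=; first by move=> _ _ Px _; exists x.
    by move=> _ _ Px _; exists x; apply: (shP [::] [::] x).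
  move=> _ cx Px _; have /hasP[b bx] : has id x by rewrite has_count; lia.
  case: b bx => // /splitPr ex _; case: ex Px => p q Px.
  by exists (p ++ false :: q); apply: (shP [::] (false :: p)).
have un1 := uniform_true unP; have sh1 := shifted_cons (b := true) shP.
have un11 := uniform_true un1; have sh11 := shifted_cons (b := true) sh1.
have P11 : intersecting (fun u => P [:: true, true & u]).
  move=> u v Pu Pv; have := P3 _ _ _ Pu Pv Py; rewrite /= !add1n add0n ltnS => lt.
  exact: leq_trans lt (inter3_drop2 _ _ _).
have un10 := uniform_false un1; have sh10 := shifted_cons (b := false) sh1.
have P10 := threewise_false sh1 (threewise_true P3).
have un0 := uniform_false unP; have sh0 := shifted_cons (b := false) shP.
have P0 := threewise_false shP P3.
rewrite (cnt_cons n.+1) (cnt_cons n (fun u => P (true :: u))) !subSS !subn0.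
have lt0 : 0 < 'C(n, k) by rewrite bin_gt0; lia.
(* Members of size 2 and 3 come first: the links of those not containing both points are then too
   small for their intersection condition, so only the links of the others count. *)
case: k lt_kn unP un1 un11 un10 un0 lt0 => [|k] lt_kn unP un1 un11 un10 un0 lt0.
  rewrite (cnt_threewise0 un10 P10) // (cnt_threewise0 un0 P0) // !addn0.
  rewrite cnt0 // => u _; apply/negP => Pu.
  by have := P11 u u Pu Pu; rewrite inter3_uu (un11 _ Pu).2.
have le11 : cnt n (fun u => P [:: true, true & u]) <= 'C(n.-1, k).
  by apply: (EKR un11) => //; lia.
have en : n = n.-1.+1 by lia.
have binn : 'C(n, k.+1) = 'C(n.-1, k.+1) + 'C(n.-1, k) by rewrite {1}en binS.
case: k lt_kn unP un1 un11 un10 un0 lt0 le11 binn => [|k] lt_kn unP un1 un11 un10 un0 lt0 le11 binn.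
  rewrite (cnt_threewise0 un10 P10) // (cnt_threewise0 un0 P0) // !addn0.
  by apply: leq_ltn_trans le11 _; rewrite binn bin0 bin1; lia.
(* Both bounds involve the same binomial [D], with factors 25/16 and 125/64, which add up to 225/64.
   Since [E] already covers the members containing both points, [b + c < B] remains to be shown. *)
have le10 := threewise_bound un10 sh10 P10 ltac:(lia) ltac:(lia).
have le0 := threewise_bound un0 sh0 P0 ltac:(lia) ltac:(lia).
have [m em] : exists m, n = m.+3 by exists (n - 3); lia.
move: le10 le0; rewrite em !subSS !subn0 => le10 le0.
have e1 := mul_bin_diag m.+2 k.+1; have e2 := mul_bin_diag m.+1 k.
rewrite em /= in le11 binn le10 le0 e1 e2 *.
have D0 : 0 < 'C(m, k) by rewrite bin_gt0; lia.
rewrite binn; move: le11 le10 le0 e1 e2 D0.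
move: ('C(m, k)) ('C(m.+1, k.+1)) ('C(m.+2, k.+2)) ('C(m.+2, k.+1)) => D X B E.
set a := cnt _ _; set b := cnt _ _; set c := cnt _ _ => le11 le10 le0 e1 e2 D0.
(* Since [m >= 2 * k + 4], the ratio [B / D] is a product of two factors above 2, and 4 exceeds
   225/64. *)
have lt : 225 * (k.+2 * k.+1) < 64 * (m.+2 * m.+1).
  have [d ->] : exists d, m = 2 * k + 4 + d by exists (m - (2 * k + 4)); lia.
  nia.
have eB : k.+2 * k.+1 * B = m.+2 * m.+1 * D.
  rewrite [LHS](_ : _ = k.+1 * (k.+2 * B)); last by lia.
  rewrite -e1 [LHS](_ : _ = m.+2 * (k.+1 * X)); last by lia.
  by rewrite -e2 mulnA.
have leD : 64 * (b + c) <= 225 * D by lia.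
have : k.+2 * k.+1 * (64 * (b + c)) < k.+2 * k.+1 * (64 * B).
  apply: (@leq_ltn_trans (k.+2 * k.+1 * (225 * D))); first by rewrite leq_mul2l leD orbT.
  rewrite [X in _ < X]mulnCA eB mulnA [X in X * _]mulnC [X in _ < X]mulnA.
  by rewrite ltn_mul2r D0.
by rewrite ltn_mul2l => /andP[_]; lia.
Qed.

(** * Sets as words *)

Section Words.
Variable n : nat.
Implicit Types (A B C : {set 'I_n}) (F : {set {set 'I_n}}).

Definition word A : seq bool := [seq i \in A | i <- enum 'I_n].

Definition word_family F : pred (seq bool) := [in [seq word A | A <- enum F]].

Lemma size_word A : size (word A) = n.
Proof. by rewrite size_map size_enum_ord. Qed.

Lemma card_count A : #|A| = count [in A] (enum 'I_n).
Proof. by rewrite enumT cardE /enum_mem size_filter. Qed.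

Lemma count_word A : count id (word A) = #|A|.
Proof. by rewrite count_map card_count. Qed.

Lemma nth_word A (i : 'I_n) : nth false (word A) i = (i \in A).
Proof. by rewrite (nth_map i) ?nth_ord_enum // size_enum_ord. Qed.

Lemma word_inj : injective word.
Proof. by move=> A B eAB; apply/setP => i; rewrite -!nth_word eAB. Qed.

Lemma inter3_word A B C : inter3 (word A) (word B) (word C) = #|A :&: B :&: C|.
Proof.
rewrite card_count /word.
by elim: (enum _) => //= i s ->; rewrite !inE andbA.
Qed.

Lemma word_familyP F u : reflect (exists2 A, A \in F & u = word A) (word_family F u).
Proof.
by apply: (iffP mapP) => -[A AF ->]; exists A => //; rewrite mem_enum in AF *.
Qed.

Lemma card_le_cnt F : #|F| <= cnt n (word_family F).
Proof.
rewrite cardE -(size_map word) /cnt -size_filter; apply: uniq_leq_size.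
  by rewrite (map_inj_uniq word_inj) enum_uniq.
by move=> u uF; rewrite mem_filter mem_words [X in X && _]uF; case/mapP: uF => A _ ->; rewrite size_word eqxx.
Qed.

Lemma nth_off v w k :
  nth false (v ++ false :: w) k = (k != size v) && nth false (v ++ true :: w) k.
Proof. by elim: v k => [|b v IH] [|k] //=; rewrite IH. Qed.

(** The right side mirrors membership in [i |: A :\ j], which carries shiftedness from sets to
    words. *)
Lemma nth_swap u v w k : nth false (u ++ true :: v ++ false :: w) k =
  (k == size u) || (k != size u + (size v).+1) && nth false (u ++ false :: v ++ true :: w) k.
Proof. by elim: u k => [|b u IH] [|k] //=; rewrite ?nth_off ?IH. Qed.

Definition set_shifted F := [forall A in F, forall i : 'I_n, forall j : 'I_n,
  (i < j) && (j \in A) && (i \notin A) ==> (i |: A :\ j \in F)].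

Lemma word_family_shifted F : set_shifted F -> shifted (word_family F).
Proof.
move=> shF u v w /word_familyP[A AF eA].
have sA := size_word A; rewrite -eA size_cat /= size_cat /= in sA.
have lti : size u < n by lia.
have ltj : size u + (size v).+1 < n by lia.
pose i := Ordinal lti; pose j := Ordinal ltj.
have iA : i \notin A by rewrite -nth_word -eA /= nth_cat ltnn subnn.
have jA : j \in A.
  rewrite -nth_word -eA /= nth_cat ltnNge leq_addr /= addKn /= nth_cat ltnn subnn //.
have ltij : i < j by rewrite /=; lia.
apply/word_familyP; exists (i |: A :\ j).
  by move/forall_inP/(_ A AF)/forallP/(_ i)/forallP/(_ j)/implyP: shF; apply; rewrite ltij jA.
apply: (@eq_from_nth _ false); first by rewrite size_word !size_cat /= size_cat.
rewrite size_cat /= size_cat /= sA => k ltk.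
rewrite nth_swap eA (nth_word A (Ordinal ltk)) (nth_word _ (Ordinal ltk)).
by rewrite !inE.
Qed.

Lemma wise_intersectingP F : reflect
  (forall A B C, A \in F -> B \in F -> C \in F -> 2 <= #|A :&: B :&: C|)
  (wise_intersecting 3 2 F).
Proof.
apply: (iffP forallP) => [F3 A B C AF BF CF | F3 G].
  have /implyP := F3 [ffun i : 'I_3 => nth A [:: A; B; C] i].
  rewrite !big_ord_recl big_ord0 !ffunE /= setIT setIA; apply.
  by apply/forallP => -[[|[|[|]]] //= ?]; rewrite ffunE.
by apply/implyP => /forallP GF; rewrite !big_ord_recl big_ord0 setIT setIA; apply: F3.
Qed.

Lemma shifted_family_bound k F (i0 i1 : 'I_n) : i0 = 0 :> nat -> i1 = 1 :> nat ->
  2 * k < n -> F \subset ksubsets n k -> wise_intersecting 3 2 F -> set_shifted F ->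
  #|F| < 'C(n - 2, k - 2) \/ {in F, forall A, [set i0; i1] \subset A}.
Proof.
move=> ei0 ei1 lt_kn Fk /wise_intersectingP F3 shF.
have [/forall_inP Fstar|] := boolP [forall A in F, [set i0; i1] \subset A].
  by right.
rewrite negb_forall_in => /exists_inP[A AF nA]; left.
apply: leq_ltn_trans (card_le_cnt F) _.
apply: (@nontrivial_bound n k _ lt_kn _ _ _ (word A)).
- move=> _ /word_familyP[B BF ->]; rewrite size_word count_word; split=> //.
  by move/subsetP/(_ B BF): Fk; rewrite inE => /eqP.
- exact: word_family_shifted.
- move=> _ _ _ /word_familyP[B BF ->] /word_familyP[C CF ->] /word_familyP[D DF ->].
  by rewrite inter3_word F3.
- by apply/word_familyP; exists A.
- by move: nA; rewrite subUset !sub1set -!nth_word ei0 ei1.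
Qed.

End Words.

(** * Shifting *)

Section Shifting.
Variable n : nat.
Implicit Types (A B C : {set 'I_n}) (F : {set {set 'I_n}}) (i j : 'I_n).

Definition moves F i j A :=
  [&& j \in A, i \notin A & i |: A :\ j \notin F].

(** Acting on one member relative to the whole of [F], the compression becomes an image of [F], and
    its size follows from injectivity. *)
Definition shift F i j A := if moves F i j A then i |: A :\ j else A.

Lemma swapK i j A : j \in A -> i \notin A -> j |: (i |: A :\ j) :\ i = A.
Proof.
move=> jA iA; apply/setP => x; rewrite !inE.
by case: (eqVneq x j) => [->|] //=; case: (eqVneq x i) => [->|] //=; rewrite (negbTE iA).
Qed.

Lemma card_swap i j A : j \in A -> i \notin A -> #|i |: A :\ j| = #|A|.
Proof.
by move=> jA iA; rewrite cardsU1 !inE (negbTE iA) andbF (cardsD1 j A) jA.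
Qed.

Lemma card_shift F i j A : #|shift F i j A| = #|A|.
Proof. by rewrite /shift; case: ifP => // /and3P[jA iA _]; apply: card_swap. Qed.

(** A moved set lands outside [F], so it cannot equal an unmoved one; two moved sets are recovered
    by swapping back. *)
Lemma shift_inj F i j : {in F &, injective (shift F i j)}.
Proof.
move=> A B AF BF; rewrite /shift.
case: ifP => [/and3P[jA iA A'F]|_]; case: ifP => [/and3P[jB iB B'F]|_] //.
- by move=> e; rewrite -(swapK jA iA) e swapK.
- by move=> e; rewrite e BF in A'F.
- by move=> e; rewrite -e AF in B'F.
Qed.

Lemma mem_shift F i j A x : x != i -> x != j -> (x \in shift F i j A) = (x \in A).
Proof. by rewrite /shift; case: ifP => // _ xi xj; rewrite !inE xj (negbTE xi). Qed.

(* A member missing [i] after shifting may have been kept although it contains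
   [j]; then its swapped version is itself in [F] and replaces it. *)
Lemma shift_threewise_moves F i j :
  (forall A B C, A \in F -> B \in F -> C \in F -> 2 <= #|A :&: B :&: C|) ->
  forall A B C, A \in F -> B \in F -> C \in F -> moves F i j A ->
  2 <= #|shift F i j A :&: shift F i j B :&: shift F i j C|.
Proof.
move=> F3 A B C AF BF CF mA; have /and3P[jA iA _] := mA.
have memA : shift F i j A = i |: A :\ j by rewrite /shift mA.
have missing B' C' : B' \in F -> C' \in F -> i \notin shift F i j B' ->
  2 <= #|shift F i j A :&: shift F i j B' :&: shift F i j C'|.
  move=> B'F C'F iB.
  have [B'' B''F B''P] : exists2 B'', B'' \in F &
      (j \notin B'') /\ (forall x, x != i -> x != j -> (x \in B'') = (x \in B')).
    have [jB|jB] := boolP (j \in B'); last by exists B'.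
    move: iB; rewrite /shift /moves jB; case: (boolP (i \in B')) => //= iB'.
      by rewrite iB'.
    case: ifP => [_|/negbFE]; first by rewrite !inE eqxx.
    move=> sF _; exists (i |: B' :\ j) => //.
    split=> [|x xi xj]; last by rewrite !inE xj (negbTE xi).
    by rewrite !inE eqxx orbF; apply: contraNneq iA => <-.
  case: B''P => jB eB; apply: leq_trans (F3 A B'' C' AF B''F C'F) _.
  apply/subset_leq_card/subsetP => x; rewrite !in_setI => /andP[/andP[xA xB] xC].
  have xi : x != i by apply: contraTneq xA => ->.
  have xj : x != j by apply: contraTneq xB => ->.
  by rewrite !mem_shift // xA -eB // xB.
have [iB|iB] := boolP (i \in shift F i j B); last exact: missing.
have [iC|iC] := boolP (i \in shift F i j C); last first.
  by rewrite setIAC; apply: missing.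
(* Now [i] lies in all three shifted sets but not in [A], so gaining [i] makes up for a possible
   loss of [j]. *)
have jX : i \notin (A :&: B :&: C) by rewrite !inE (negbTE iA).
have : #|i |: (A :&: B :&: C) :\ j| <= #|shift F i j A :&: shift F i j B :&: shift F i j C|.
  apply/subset_leq_card/subsetP => x; rewrite !in_setI in_setU1.
  case: (eqVneq x i) => [-> _|xi] /=; first by rewrite memA iB iC !inE eqxx.
  rewrite !in_setD1 !in_setI => /andP[xj /andP[/andP[xA xB] xC]].
  by rewrite !mem_shift // xA xB.
apply: leq_trans; rewrite cardsU1 in_setD1 (negbTE jX) andbF add1n.
have := F3 A B C AF BF CF; rewrite (cardsD1 j (A :&: B :&: C)); case: (j \in _) => //.
by rewrite add0n; apply: leqW.
Qed.

Lemma shift_threewise F i j :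
  wise_intersecting 3 2 F -> wise_intersecting 3 2 (shift F i j @: F).
Proof.
move=> /wise_intersectingP F3; have moved := shift_threewise_moves F3 (i := i) (j := j).
apply/wise_intersectingP => _ _ _ /imsetP[A AF ->] /imsetP[B BF ->] /imsetP[C CF ->].
have [mA|mA] := boolP (moves F i j A); first exact: moved.
have [mB|mB] := boolP (moves F i j B).
  by rewrite [shift _ _ _ A :&: _]setIC; apply: moved.
have [mC|mC] := boolP (moves F i j C).
  by rewrite setIC setIA; apply: moved.
by rewrite /shift (negbTE mA) (negbTE mB) (negbTE mC) F3.
Qed.

Lemma shift_ksubsets k F i j :
  F \subset ksubsets n k -> shift F i j @: F \subset ksubsets n k.
Proof.
move=> /subsetP Fk; apply/subsetP => _ /imsetP[A /Fk + ->].
by rewrite !inE card_shift.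
Qed.

(** Termination measure for repeated compression. *)
Definition weight F := \sum_(A in F) \sum_(x in A) (x : nat).

Lemma weight_swap i j A : i < j -> j \in A -> i \notin A ->
  \sum_(x in i |: A :\ j) (x : nat) < \sum_(x in A) (x : nat).
Proof.
move=> ltij jA iA; rewrite big_setU1 /=; last by rewrite !inE (negbTE iA) andbF.
by rewrite [in X in _ < X](big_setD1 j) //= ltn_add2r.
Qed.

Lemma weight_shift F i j A : i < j -> A \in F -> moves F i j A ->
  weight (shift F i j @: F) < weight F.
Proof.
move=> ltij AF mA; rewrite /weight big_imset; last exact: shift_inj.
rewrite (bigD1 A) //= [X in _ < X](bigD1 A) //= -addSn leq_add //.
  by rewrite {1}/shift mA; case/and3P: mA => jA iA _; apply: weight_swap.
apply: leq_sum => B _; rewrite /shift; case: ifP => // /and3P[jB iB _].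
exact/ltnW/weight_swap.
Qed.

(** * Stars and the case of equality *)

Lemma card_star k (T : {set 'I_n}) : #|T| <= k ->
  #|[set A in ksubsets n k | T \subset A]| = 'C(n - #|T|, k - #|T|).
Proof.
move=> leTk; have cT : #|~: T| = n - #|T| by rewrite cardsCs setCK card_ord.
rewrite -cT -cards_draws -[RHS](@card_in_imset _ _ (fun A => T :|: A)).
  apply: eq_card => A; apply/idP/imsetP.
    rewrite !inE => /andP[/eqP cA TA]; exists (A :\: T).
      by rewrite inE subDset setUCr subsetT cardsDS // cA eqxx.
    apply/setP => x; rewrite !inE.
    by have [/(subsetP TA) ->|] := boolP (x \in T).
  case=> B; rewrite inE => /andP[BT /eqP cB] ->.
  rewrite !inE subsetUl andbT cardsU cB.
  suff -> : T :&: B = set0 by rewrite cards0 subn0 subnKC.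
  by apply/eqP; rewrite setI_eq0 disjoint_sym disjoints_subset.
move=> A B; rewrite !inE => /andP[AT _] /andP[BT _] eAB; apply/setP => x.
have [xT|xT] := boolP (x \in T).
  have memF (D : {set 'I_n}) : D \subset ~: T -> x \in D = false.
    by move=> DT; apply/negP => /(subsetP DT); rewrite inE xT.
  by rewrite !memF.
by move/setP/(_ x): eAB; rewrite !inE (negbTE xT).
Qed.

Lemma two_subset_family_star k F (T : {set 'I_n}) : 2 <= k -> F \subset ksubsets n k ->
  #|F| = 'C(n - 2, k - 2) -> #|T| = 2 -> {in F, forall A, T \subset A} ->
  full_star k 2 F.
Proof.
move=> le2k Fk cF cT FT; exists T => //; apply/eqP.
rewrite eqEcard card_star cT // cF leqnn andbT.
by apply/subsetP => A AF; rewrite inE (subsetP Fk _ AF) FT.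
Qed.

Lemma exists_subset (X : {set 'I_n}) m : m <= #|X| -> exists2 Y : {set 'I_n}, Y \subset X & #|Y| = m.
Proof.
move=> lemX; have : 0 < #|[set Y : {set 'I_n} | Y \subset X & #|Y| == m]|.
  by rewrite cards_draws bin_gt0.
by case/card_gt0P => Y; rewrite inE => /andP[YX /eqP]; exists Y.
Qed.

Lemma full_star_shift k F i j : 2 <= k -> 2 * k < n ->
  F \subset ksubsets n k -> wise_intersecting 3 2 F ->
  #|F| = 'C(n - 2, k - 2) -> full_star k 2 (shift F i j @: F) -> full_star k 2 F.
Proof.
move=> le2k lt_kn Fk /wise_intersectingP F3 cF [T cT eF].
(* Disjoint [Y1] and [Y2] avoiding [T] and [j] need at most [2 * (k - 2) + 3] points, and
   [2 * k < n] provides them. *)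
have [Y1 Y1T cY1] : exists2 Y1 : {set 'I_n}, Y1 \subset ~: (j |: T) & #|Y1| = k - 2.
  apply: exists_subset; rewrite cardsCs setCK card_ord cardsU1 cT.
  by case: (j \notin T); lia.
have [Y2 Y2T cY2] : exists2 Y2 : {set 'I_n}, Y2 \subset ~: (j |: T) :\: Y1 & #|Y2| = k - 2.
  apply: exists_subset; rewrite cardsDS // cardsCs setCK card_ord cardsU1 cT cY1.
  by case: (j \notin T); lia.
have preim (Y : {set 'I_n}) : Y \subset ~: (j |: T) -> #|Y| = k - 2 ->
    exists2 A, A \in F & shift F i j A = T :|: Y.
  move=> YT cY; have : T :|: Y \in shift F i j @: F; last first.
    by case/imsetP => A AF eA; exists A.
  rewrite eF !inE subsetUl andbT cardsU cT cY.
  suff -> : T :&: Y = set0 by rewrite cards0; apply/eqP; lia.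
  apply/eqP; rewrite setI_eq0 disjoint_sym disjoints_subset.
  by apply: subset_trans YT _; rewrite setCS subsetUr.
have [A1 A1F e1] := preim _ Y1T cY1.
have [A2 A2F e2] := preim Y2 (subset_trans Y2T (subsetDl _ _)) cY2.
have disj x : x \in Y1 -> x \in Y2 -> false.
  by move=> x1 /(subsetP Y2T); rewrite inE x1.
(* If both preimages moved, then [i] is in [T] and they meet inside [T] with [i] replaced by [j]. If
   only one moved, it lacks [i] and the other lacks [j], so they meet inside [T]; likewise if none
   moved. *)
have common : #|A1 :&: A2| <= 2.
  have memT x : x != i -> x != j -> x \in A1 :&: A2 -> x \in T.
    move=> xi xj; rewrite inE -(mem_shift F A1 xi xj) -(mem_shift F A2 xi xj) e1 e2 !inE.
    by case: (x \in T) => //= /andP[]; apply: disj.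
  have movedP A Y : shift F i j A = T :|: Y -> moves F i j A ->
      [/\ i \notin A, i \in T :|: Y & j \notin T].
    move=> e mA; have /and3P[jA iA _] := mA; split=> //.
      by rewrite -e /shift mA !inE eqxx.
    apply: contraNN iA => jT; have : j \in T :|: Y by rewrite inE jT.
    by rewrite -e /shift mA !inE eqxx orbF => /eqP <-.
  have unmoved A (Y : {set 'I_n}) : Y \subset ~: (j |: T) -> shift F i j A = T :|: Y ->
      ~~ moves F i j A -> j \notin T -> j \notin A.
    move=> YT e mA jT; rewrite /shift (negbTE mA) in e; rewrite e inE (negbTE jT) /=.
    by apply/negP => /(subsetP YT); rewrite !inE eqxx.
  have Y2T' := subset_trans Y2T (subsetDl _ _).
  have [m1|m1] := boolP (moves F i j A1); have [m2|m2] := boolP (moves F i j A2).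
  - have [i1 iT1 jT] := movedP _ _ e1 m1; have [_ iT2 _] := movedP _ _ e2 m2.
    have iT : i \in T.
      by move: iT1 iT2; rewrite !inE; case: (i \in T) => //=; apply: disj.
    apply: (@leq_trans #|j |: T :\ i|); last first.
      by rewrite cardsU1 -cT (cardsD1 i T) iT; case: (_ \notin _).
    apply/subset_leq_card/subsetP => x xA; rewrite in_setU1 in_setD1.
    have [//|xj] := eqVneq x j; have xi : x != i.
      by apply: contraNneq i1 => <-; case/setIP: xA.
    by rewrite xi memT.
  - have [i1 _ jT] := movedP _ _ e1 m1; have j2 := unmoved _ _ Y2T' e2 m2 jT.
    rewrite -cT; apply/subset_leq_card/subsetP => x xA; apply: memT => //.
      by apply: contraNneq i1 => <-; case/setIP: xA.
    by apply: contraNneq j2 => <-; case/setIP: xA.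
  - have [i2 _ jT] := movedP _ _ e2 m2; have j1 := unmoved _ _ Y1T e1 m1 jT.
    rewrite -cT; apply/subset_leq_card/subsetP => x xA; apply: memT => //.
      by apply: contraNneq i2 => <-; case/setIP: xA.
    by apply: contraNneq j1 => <-; case/setIP: xA.
  - rewrite /shift (negbTE m1) in e1; rewrite /shift (negbTE m2) in e2.
    rewrite -cT; apply/subset_leq_card/subsetP => x; rewrite e1 e2 !inE.
    by case: (x \in T) => //= /andP[]; apply: disj.
have ge2 A : A \in F -> 2 <= #|A1 :&: A2 :&: A| by move=> AF; apply: F3.
have cA : #|A1 :&: A2| = 2.
  apply/eqP; rewrite eqn_leq common; apply: leq_trans (ge2 _ A1F) _.
  exact/subset_leq_card/subsetIl.
apply: (two_subset_family_star le2k Fk cF cA) => A AF.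
apply/setIidPl/eqP; rewrite eqEcard subsetIl cA; exact: ge2.
Qed.

(** Induction on [weight]: a family that is not shifted admits a shift that keeps its size and
    lowers its weight, and [full_star_shift] brings the star structure back. *)
Lemma threewise_family k F : 2 <= k -> 2 * k < n ->
  F \subset ksubsets n k -> wise_intersecting 3 2 F ->
  #|F| <= 'C(n - 2, k - 2) /\ (#|F| = 'C(n - 2, k - 2) -> full_star k 2 F).
Proof.
move=> le2k lt_kn; have [w] := ubnP (weight F); elim: w F => // w IH F ltw Fk F3.
have [shF|] := boolP (set_shifted F).
  have lt0 : 0 < n by lia.
  have lt1 : 1 < n by lia.
  have [|Fstar] := @shifted_family_bound n k F (Ordinal lt0) (Ordinal lt1) erefl erefl lt_kn Fk F3 shF.
    by move=> lt; split=> [|e]; [exact: ltnW | rewrite e ltnn in lt].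
  have cT : #|[set Ordinal lt0; Ordinal lt1]| = 2 by rewrite cards2.
  split=> [|cF]; last exact: two_subset_family_star cT Fstar.
  rewrite -cT -card_star ?cT //; apply/subset_leq_card/subsetP => A AF.
  by rewrite inE (subsetP Fk _ AF) Fstar.
rewrite negb_forall_in => /exists_inP[A AF]; rewrite negb_forall => /existsP[i].
rewrite negb_forall => /existsP[j]; rewrite negb_imply => /andP[/andP[/andP[ltij jA] iA] nF].
have mA : moves F i j A by rewrite /moves jA iA nF.
have cS : #|shift F i j @: F| = #|F| by apply: card_in_imset; apply: shift_inj.
have [] := IH (shift F i j @: F).
- exact: leq_trans (weight_shift ltij AF mA) _.
- exact: shift_ksubsets.
- exact: shift_threewise.
rewrite cS => le eqP; split=> // cF; apply: (@full_star_shift k F i j) => //; exact: eqP.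
Qed.

End Shifting.

Theorem theorem1p4 (n k : nat) (hkn : 2 * k < n) (hk : 4 <= 2 * k) :
  max_wise_intersecting n k 3 2 = 'C(n - 2, k - 2) /\
  (forall F : {set {set 'I_n}},
     F \subset ksubsets n k ->
     wise_intersecting 3 2 F ->
     #|F| = 'C(n - 2, k - 2) ->
     full_star k 2 F).
Proof.
have le2k : 2 <= k by lia.
split; last by move=> F Fk F3; have [] := threewise_family le2k hkn Fk F3.
apply/eqP; rewrite eqn_leq; apply/andP; split.
  by apply/bigmax_leqP => F /andP[Fk F3]; have [] := threewise_family le2k hkn Fk F3.
(* The lower bound is attained by the full star on any two points. *)
have [T _ cT] : exists2 T : {set 'I_n}, T \subset [set: 'I_n] & #|T| = 2.
  by apply: exists_subset; rewrite cardsT card_ord; lia.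
have := card_star (T := T) (k := k); rewrite cT => /(_ le2k) <-.
apply: (bigmax_sup [set A in ksubsets n k | T \subset A]) => //; apply/andP; split.
  by apply/subsetP => A; rewrite inE => /andP[].
apply/wise_intersectingP => A B C; rewrite !inE => /andP[_ TA] /andP[_ TB] /andP[_ TC].
by rewrite -cT subset_leq_card // !subsetI TA TB TC.
Qed.
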